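(* Consider a power system as described in the context, and let $\mathcal{I} = \{\mathcal{I}_\ell\}_{\ell=1}^{\hat n}$ be a partition of $\mathcal{G} = \{1,\dots,n\}$ with $|\mathcal{I}| = \hat n \ge 2$. Let $M, D \in \mathcal{S}_{\mathrm{cl}}$ and $f, E \in \mathcal{X}_{\mathrm{cl}}$. Then the power system is weakly synchronized with respect to $\mathcal{I}$ if and only if $$L_{\mathrm{D}} \in \mathcal{S}_{\mathrm{cl}} \quad\text{and}\quad \mathcal{X}_{\mathrm{cl}} \text{ is } \Gamma\text{-invariant (i.e. } \Gamma\mathcal{X}_{\mathrm{cl}} \subseteq \mathcal{X}_{\mathrm{cl}}).$$
   Context: Power system. Let $n \ge 1$, $\bar n \ge 0$, $\mathcal{G} = \{1,\dots,n\}$ (generators and their generator buses), $\overline{\mathcal{G}} = \{n+1,\dots,n+\bar n\}$ (non-generator buses). Given are constants $M_i > 0$, $D_i \ge 0$, $f_i \in \mathbb{R}$, $E_i > 0$, $\chi_i > 0$ for $i \in \mathcal{G}$, and a connected undirected graph on the buses $\mathcal{G} \cup \overline{\mathcal{G}}$ with a reactance $\chi_{ij} = \chi_{ji} > 0$ on each edge. Put $M = \mathrm{diag}(M_i)$, $D = \mathrm{diag}(D_i)$, $f = (f_i)$, $E = (E_i)$, $L_{\mathrm{D}} = \mathrm{diag}(\chi_1^{-1},\dots,\chi_n^{-1})$. Let $L \in \mathbb{R}^{(n+\bar n)\times(n+\bar n)}$ be the weighted graph Laplacian: for $i\neq j$, its $(i,j)$ entry is $-\chi_{ij}^{-1}$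 if buses $i,j$ are adjacent and $0$ otherwise, and its diagonal entries make all row sums $0$. Partition $L = \begin{bmatrix} L_{11} & L_{12} \\ L_{12}^{\mathsf T} & L_{22}\end{bmatrix}$ according to $\mathcal{G}, \overline{\mathcal{G}}$ (if $\bar n = 0$, read $L_{11} - L_{12}L_{22}^{-1}L_{12}^{\mathsf T}$ as $L_{11}$). The unknowns are the generator phases $\delta(t) \in \mathbb{R}^n$ and the complex bus voltages $\mathbf{V}_{\mathcal{G}}(t) = [V_i(t)(\cos\theta_i(t) + \imath \sin\theta_i(t))]_{i \in \mathcal{G}} \in \mathbb{C}^n$ and $\mathbf{V}_{\overline{\mathcal{G}}}(t) \in \mathbb{C}^{\bar n}$, where $V_i(t)$, $\theta_i(t)$ are voltage amplitude and phase. With $\mathbf{E}_{\mathcal{G}}(t) = [E_i(\cos\delta_i(t) + \imath\sin\delta_i(t))]_{i\in\mathcal{G}}$, the power system is the differential-algebraic system, $t \ge 0$, $$M\ddot\delta(t) + D\dot\delta(t) = f - \Big[\tfrac{E_iV_i(t)}{\chi_i}\sin(\delta_i(t)-\theta_i(t))\Big]_{i\in\mathcal{G}}, \qquad \begin{bmatrix} L_{\mathrm{D}}(\mathbf{E}_{\mathcal{G}}(t) - \mathbf{V}_{\mathcal{G}}(t)) \\ 0\end{bmatrix} = \begin{bmatrix} L_{11} & L_{12} \\ L_{12}^{\mathsf T} & L_{22}\end{bmatrix}\begin{bmatrix}\mathbf{V}_{\mathcal{G}}(t)\\ \mathbf{V}_{\overline{\mathcal{G}}}(t)\end{bmatrix}.$$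 Set $\Gamma = L_{\mathrm{D}}(L_{\mathrm{D}} + L_{11} - L_{12}L_{22}^{-1}L_{12}^{\mathsf T})^{-1}L_{\mathrm{D}}$, which is positive definite with positive entries. The system is equivalent to the Kron-reduced form $M_i\ddot\delta_i + D_i\dot\delta_i = f_i - \sum_{k=1}^n \Gamma_{ik}E_iE_k\sin(\delta_i-\delta_k)$, $i\in\mathcal{G}$, together with $L_{\mathrm{D}}\mathbf{V}_{\mathcal{G}}(t) = \Gamma\mathbf{E}_{\mathcal{G}}(t)$ and $\mathbf{V}_{\overline{\mathcal{G}}}(t) = -L_{22}^{-1}L_{12}^{\mathsf T}\mathbf{V}_{\mathcal{G}}(t)$. Notation. $\mathcal{X}_{ij} = \{x \in \mathbb{R}^n : x_i = x_j\}$; $\Pi_{ij}$ is the $n\times n$ permutation matrix of the transposition of $i$ and $j$ (identity if $i=j$), and $\mathcal{S}_{ij} = \{A \in \mathbb{R}^{n\times n} : A\Pi_{ij} = \Pi_{ij}A\}$. For a partition $\mathcal{I} = \{\mathcal{I}_\ell\}_{\ell=1}^{\hat n}$ of $\mathcal{G}$ into nonempty disjoint clusters, $\mathcal{X}_{\mathrm{cl}} = \bigcap_{\ell}\bigcap_{i,j\in\mathcal{I}_\ell}\mathcal{X}_{ij}$ (vectors constant on each cluster) and $\mathcal{S}_{\mathrm{cl}} = \bigcap_{\ell}\bigcap_{i,j\in\mathcal{I}_\ell}\mathcal{S}_{ij}$. For a complex vector, ''$x\in\mathcal{X}_{\mathrm{cl}}$'' likewise means that $x$ is constant on each cluster. Definition.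 The power system is weakly synchronized with respect to $\mathcal{I}$ if, for every initial condition $\delta(0),\dot\delta(0)\in\mathcal{X}_{\mathrm{cl}}$, the solution satisfies $\delta(t)\in\mathcal{X}_{\mathrm{cl}}$ and $\mathbf{V}_{\mathcal{G}}(t)\in\mathcal{X}_{\mathrm{cl}}$ for all $t\ge0$. *)

(* Defs.v *)
From mathcomp Require Import all_boot all_order all_algebra.
From mathcomp Require Import all_classical all_reals all_analysis.
From mathcomp Require Import complex.

Set Implicit Arguments.
Unset Strict Implicit.
Unset Printing Implicit Defensive.

Import Order.TTheory GRing.Theory Num.Theory.
Import numFieldNormedType.Exports.

Local Open Scope classical_set_scope.
Local Open Scope ring_scope.

(* Generators and generator buses are indexed by 'I_n, all buses by
   'I_(n + nbar), the generator buses coming first (via [lshift]). *)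
Record power_system (R : realType) (n nbar : nat) := PowerSystem {
  inertia : 'I_n -> R;
  damping : 'I_n -> R;
  mech_power : 'cV[R]_n;
  emf : 'cV[R]_n;
  gen_reactance : 'I_n -> R;
  line : rel 'I_(n + nbar);
  line_reactance : 'I_(n + nbar) -> 'I_(n + nbar) -> R;
  inertia_gt0 : forall i, 0 < inertia i;
  damping_ge0 : forall i, 0 <= damping i;
  emf_gt0 : forall i, 0 < emf i 0;
  gen_reactance_gt0 : forall i, 0 < gen_reactance i;
  line_irreflexive : irreflexive line;
  line_symmetric : symmetric line;
  line_connected : forall i j, connect line i j;
  line_reactance_gt0 : forall i j, line i j -> 0 < line_reactance i j;
  line_reactance_sym : forall i j, line i j ->
    line_reactance i j = line_reactance j i
}.

Section Network.
Variables (R : realType) (n nbar : nat) (PS : power_system R n nbar).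

Definition inertia_mx : 'M[R]_n := diag_mx (\row_i inertia PS i).
Definition damping_mx : 'M[R]_n := diag_mx (\row_i damping PS i).
Definition LD : 'M[R]_n := diag_mx (\row_i (gen_reactance PS i)^-1).

Definition laplacian : 'M[R]_(n + nbar) :=
  \matrix_(i, j)
    if i == j then \sum_(k | line PS i k) (line_reactance PS i k)^-1
    else if line PS i j then - (line_reactance PS i j)^-1 else 0.

Definition L11 : 'M[R]_n := ulsubmx laplacian.
Definition L12 : 'M[R]_(n, nbar) := ursubmx laplacian.
Definition L22 : 'M[R]_nbar := drsubmx laplacian.

(* For [nbar = 0] the product [L12 *m _ *m L12^T] is the zero matrix. *)
Definition Gamma : 'M[R]_n :=
  LD *m invmx (LD + L11 - L12 *m invmx L22 *m L12^T) *m LD.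

Definition polar (r phi : 'cV[R]_n) : 'cV[R[i]]_n :=
  \col_i Complex (r i 0 * cos (phi i 0)) (r i 0 * sin (phi i 0)).

Definition complexify p q (A : 'M[R]_(p, q)) : 'M[R[i]]_(p, q) :=
  map_mx (real_complex R) A.

(* Derivative relative to [0, +oo[: two-sided for t > 0, right for t = 0. *)
Definition has_derivative_at (x : R -> 'cV[R]_n) (t : R) (l : 'cV[R]_n) : Prop :=
  h^-1 *: (x (t + h) - x t) @[h --> within [set h | 0 <= t + h] 0^'] --> l.

(* [omega] is the derivative of [delta]; [V] and [theta] are the amplitudes and
   phases of the generator-bus voltages, [VN] the other bus voltages. *)
Record is_solution (delta omega V theta : R -> 'cV[R]_n)
    (VN : R -> 'cV[R[i]]_nbar) : Prop := IsSolution {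
  sol_velocity : forall t, 0 <= t -> has_derivative_at delta t (omega t);
  sol_swing : forall t, 0 <= t -> exists2 alpha : 'cV[R]_n,
    has_derivative_at omega t alpha &
    inertia_mx *m alpha + damping_mx *m omega t =
      mech_power PS -
      \col_i (emf PS i 0 * V t i 0 / gen_reactance PS i
              * sin (delta t i 0 - theta t i 0));
  sol_amplitude : forall t, 0 <= t -> forall i, 0 <= V t i 0;
  sol_network : forall t, 0 <= t ->
    col_mx (complexify LD *m (polar (emf PS) (delta t) - polar (V t) (theta t)))
           0 =
    complexify laplacian *m col_mx (polar (V t) (theta t)) (VN t)
}.

End Network.

Definition X2 (T : Type) n (i j : 'I_n) : set 'cV[T]_n :=
  [set x | x i 0 = x j 0].

Definition S2 (R : realType) n (i j : 'I_n) : set 'M[R]_n :=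
  [set A | A *m tperm_mx i j = tperm_mx i j *m A].

Definition Xcl (T : Type) n (I : {set {set 'I_n}}) : set 'cV[T]_n :=
  [set x | forall C, C \in I -> forall i j, i \in C -> j \in C -> X2 i j x].

Definition Scl (R : realType) n (I : {set {set 'I_n}}) : set 'M[R]_n :=
  [set A | forall C, C \in I -> forall i j, i \in C -> j \in C -> S2 i j A].

Definition weakly_synchronized (R : realType) n nbar
    (PS : power_system R n nbar) (I : {set {set 'I_n}}) : Prop :=
  forall (delta omega V theta : R -> 'cV[R]_n) (VN : R -> 'cV[R[i]]_nbar),
    is_solution PS delta omega V theta VN ->
    Xcl I (delta 0) -> Xcl I (omega 0) ->
    forall t, 0 <= t ->
      Xcl I (delta t) /\ Xcl I (polar (V t) (theta t)).

(* Main.v *)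
(* The network equations say that v solves a grounded Laplacian system; a discrete
   minimum principle on the connected graph makes this system uniquely solvable,
   with positive solutions for nonzero e >= 0, and elimination of the
   non-generator buses gives LD v = Gamma e for both real and imaginary parts.

   If LD and Gamma respect the clusters, the swing equation has a field that maps
   cluster-constant states to cluster-constant ones; being Lipschitz, it keeps the
   differences between a generator and a representative of its cluster at 0 by
   Gronwall's inequality, and the voltages follow from LD V = Gamma E.

   Conversely every initial phase in Xcl starts a global solution (Picard), along
   which weak synchronization forces both the voltages and the delivered powers to
   be constant on clusters at time 0. Phase pi/2 on a single cluster and 0
   elsewhere then gives LD in Scl, and phases asin (c x_k / E_k) with c > 0 small
   give Gamma x in Xcl. *)
Require Import Defs.
From mathcomp Require Import all_boot all_order all_algebra.
From mathcomp Require Import all_classical all_reals all_analysis.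
From mathcomp Require Import perm complex ring lra.

Set Implicit Arguments.
Unset Strict Implicit.
Unset Printing Implicit Defensive.

Import Order.TTheory GRing.Theory Num.Theory.
Import numFieldNormedType.Exports.

Local Open Scope classical_set_scope.
Local Open Scope ring_scope.

(** * Ordinary differential equations *)

Section OrdinaryDifferentialEquations.
Variable R : realType.
Implicit Types (f g G : R -> R) (t s : R).

Lemma is_derive_continuous f t (df : R) : is_derive t 1 f df -> {for t, continuous f}.
Proof.
by move=> [fD _]; apply: differentiable_continuous; apply/derivable1_diffP.
Qed.

(** Mean value theorem on [[0, t]]. At the left end only right continuity is assumed, which is what
    a derivative relative to the half-line provides there. *)
Lemma ge0_derive_le f (df : R -> R) t :
  (forall s, 0 < s -> is_derive s 1 f (df s)) -> f s @[s --> 0^'+] --> f 0 ->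
  (forall s, 0 < s -> 0 <= df s) -> 0 <= t -> f 0 <= f t.
Proof.
move=> fD f0 df_ge0; rewrite le_eqVlt => /predU1P[<-//|t_gt0].
have cont : {within `[0, t], continuous f}.
  suff : {within `[0, +oo[, continuous f}.
    by apply: continuous_subspaceW => s /=; rewrite !in_itv/= andbT => /andP[].
  apply/continuous_within_itvcyP; split => // s; rewrite in_itv/= andbT => s_gt0.
  exact/is_derive_continuous/fD.
have fD' s : s \in `]0, t[ -> is_derive s 1 f (df s).
  by rewrite in_itv/= => /andP[s_gt0 _]; exact: fD.
have [c /itvP cI fE] := MVT t_gt0 fD' cont.
by rewrite -subr_ge0 fE mulr_ge0// ?subr_ge0 ?(ltW t_gt0)// df_ge0// cI.
Qed.

Lemma exists_primitive f : continuous f ->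
  exists G, G 0 = 0 /\ forall t, 0 <= t -> is_derive t 1 G (f t).
Proof.
(* Integrating from -1 makes 0 an interior point, so that the derivative at 0 is two-sided. *)
move=> cf; set F := fun x => (\int[lebesgue_measure]_(t in `[(-1)%R, x]) f t)%R.
have FD t : 0 <= t -> is_derive t 1 F (f t).
  move=> t_ge0.
  have intf : lebesgue_measure.-integrable `[(-1)%R, t + 1] (EFin \o f).
    apply: continuous_compact_integrable; first exact: segment_compact.
    exact: continuous_subspaceT.
  have [|||] := @continuous_FTC1_closed _ f (-1) t (t + 1) _ intf.
  - by rewrite ltrDl.
  - by rewrite (lt_le_trans _ t_ge0)// oppr_lt0.
  - exact: cf.
  by rewrite derive1E => FD <-; split.
exists (fun x => F x - F 0); split; first by rewrite subrr.
move=> t /FD FDt; apply: is_derive_eq; by rewrite subr0.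
Qed.

Lemma derive_expRM (k t : R) :
  is_derive t 1 (fun s => expR (k * s)) (k * expR (k * t)).
Proof.
have -> : (fun s => expR (k * s)) = expR \o (fun s => k * s) by [].
have kD : is_derive t 1 (fun s : R => k * s) k.
  by apply: is_derive_eq; rewrite /GRing.scale/=; ring.
by apply: is_derive_eq; rewrite mulrC.
Qed.

(** Both functions [c / k * expR (k * t) + b * G t] with [b] = 1 or -1 are nonnegative at 0 and have
    nonnegative derivative. The factor [1 / k] gained by integration is the source of the
    contraction in the Picard iteration. *)
Lemma exp_growth_bound (k c : R) G g t : 0 < k -> G 0 = 0 -> 0 <= c ->
  (forall s, 0 <= s -> is_derive s 1 G (g s)) ->
  (forall s, 0 <= s -> `|g s| <= c * expR (k * s)) ->
  0 <= t -> `|G t| <= c / k * expR (k * t).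
Proof.
move=> k_gt0 G0 c_ge0 GD gb t_ge0.
suff H (b : R) (b1 : `|b| = 1) : 0 <= c / k * expR (k * t) + b * G t.
  have := H 1; have := H (-1); rewrite normrN normr1 ler_norml => /(_ erefl) ? /(_ erefl) ?.
  by lra.
pose h s := c / k * expR (k * s) + b * G s.
pose dh s := c * expR (k * s) + b * g s.
have hD s : 0 <= s -> is_derive s 1 h (dh s).
  move=> s_ge0; have ? := GD s s_ge0; have ? := derive_expRM k s.
  apply: is_derive_eq; rewrite /dh /GRing.scale/=.
  by field; rewrite gt_eqF.
have h0 : 0 <= h 0.
  by rewrite /h G0 (mulr0 b) addr0 mulr_ge0 ?expR_ge0// divr_ge0// ltW.
apply: (le_trans h0); apply: (@ge0_derive_le h dh t _ _ _ t_ge0).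
- by move=> s s_gt0; apply: hD; exact: ltW.
- apply: cvg_at_right_filter; exact: is_derive_continuous (hD 0 (lexx 0)).
move=> s s_gt0; have := gb s (ltW s_gt0); rewrite /dh.
have : `|b * g s| <= `|g s| by rewrite normrM b1 mul1r.
by have := ler_norm (- (b * g s)); rewrite normrN; lra.
Qed.

(** The intervals of centre [u k] and radius [2 * c / 2 ^+ k], the tail of the geometric series, are
    nested; the limit is the supremum of their left ends. *)
Lemma geometric_limit (u : nat -> R) (c : R) :
  (forall k, `|u k.+1 - u k| <= c / 2 ^+ k) ->
  exists l, forall k, `|u k - l| <= 2 * c / 2 ^+ k.
Proof.
move=> uc; pose r k := 2 * c / 2 ^+ k.
have rS k : r k.+1 = c / 2 ^+ k.
  by rewrite /r exprS; field; rewrite expf_neq0// lt0r_neq0.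
have rSS k : r k = c / 2 ^+ k + c / 2 ^+ k by rewrite /r; lra.
have le_lo k d : u k - r k <= u (k + d)%N - r (k + d)%N.
  elim: d => [|d]; first by rewrite addn0.
  move=> /le_trans; apply; rewrite addnS rS rSS.
  by have := uc (k + d)%N; rewrite ler_norml => /andP[? ?]; lra.
have ge_hi k d : u (k + d)%N + r (k + d)%N <= u k + r k.
  elim: d => [|d]; first by rewrite addn0.
  apply: le_trans; rewrite addnS rS rSS.
  by have := uc (k + d)%N; rewrite ler_norml => /andP[? ?]; lra.
have r_ge0 k : 0 <= r k by have := le_trans (normr_ge0 _) (uc k); rewrite rSS; lra.
have lo_hi k m : u k - r k <= u m + r m.
  have := le_lo k m; have := ge_hi m k; have := r_ge0 (k + m)%N.
  by rewrite (addnC m k); lra.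
pose A := [set x | exists k, x = u k - r k].
have supA : has_sup A.
  by split; [exists (u 0%N - r 0%N), 0%N | exists (u 0%N + r 0%N) => _ [k ->]].
exists (sup A) => k; rewrite -/(r k) ler_norml; apply/andP; split.
  suff : sup A <= u k + r k by lra.
  by apply: ge_sup; [case: supA | move=> _ [m ->]].
suff : u k - r k <= sup A by lra.
by apply: ub_le_sup; [case: supA | exists k].
Qed.

End OrdinaryDifferentialEquations.

(** * Lipschitz functionals of finitely many real coordinates *)

Section LipschitzFunctionals.
Variables (R : realType) (J : finType).
Implicit Types (a b : J -> R) (phi psi : (J -> R) -> R).

Definition dist1 a b : R := \sum_j `|a j - b j|.

Definition lipschitz1 phi : Prop :=
  exists2 k : R, 0 <= k & forall a b, `|phi a - phi b| <= k * dist1 a b.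

Lemma dist1_ge0 a b : 0 <= dist1 a b.
Proof. by apply: sumr_ge0 => j _; exact: normr_ge0. Qed.

Lemma lipschitz1_cst (c : R) : lipschitz1 (fun=> c).
Proof. by exists 0 => // a b; rewrite subrr normr0 mul0r. Qed.

Lemma lipschitz1_proj j : lipschitz1 (fun a => a j).
Proof.
exists 1 => // a b; rewrite mul1r /dist1 (bigD1 j)//= lerDl.
by apply: sumr_ge0 => i _; exact: normr_ge0.
Qed.

Lemma lipschitz1B phi psi :
  lipschitz1 phi -> lipschitz1 psi -> lipschitz1 (fun a => phi a - psi a).
Proof.
move=> [k k_ge0 phiL] [l l_ge0 psiL]; exists (k + l); first exact: addr_ge0.
move=> a b; have -> : phi a - psi a - (phi b - psi b) =
  (phi a - phi b) - (psi a - psi b) by ring.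
by rewrite mulrDl (le_trans (ler_normB _ _))// lerD.
Qed.

Lemma lipschitz1M (c : R) phi : lipschitz1 phi -> lipschitz1 (fun a => c * phi a).
Proof.
move=> [k k_ge0 phiL]; exists (`|c| * k); first exact: mulr_ge0.
by move=> a b; rewrite -mulrBr normrM -mulrA ler_wpM2l.
Qed.

Lemma lipschitz1_uniform (I : finType) (phi : I -> (J -> R) -> R) :
  (forall i, lipschitz1 (phi i)) ->
  exists2 k : R, 0 <= k & forall i a b, `|phi i a - phi i b| <= k * dist1 a b.
Proof.
move=> /(_ _)/cid2 phiL; pose k i := s2val (phiL i).
have k_ge0 i : 0 <= k i by exact: (s2valP (phiL i)).
exists (\sum_i k i); first exact: sumr_ge0.
move=> i a b; apply: le_trans (s2valP' (phiL i) a b) _.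
by rewrite ler_wpM2r ?dist1_ge0// (bigD1 i)//= lerDl sumr_ge0.
Qed.

Lemma lipschitz1_sum (I : finType) (phi : I -> (J -> R) -> R) :
  (forall i, lipschitz1 (phi i)) -> lipschitz1 (fun a => \sum_i phi i a).
Proof.
move=> /lipschitz1_uniform[k k_ge0 phiL]; exists (k *+ #|I|); first exact: mulrn_wge0.
move=> a b; rewrite -sumrB (le_trans (ler_norm_sum _ _ _))//.
rewrite mulrnAl -sumr_const; exact: ler_sum.
Qed.

Lemma ler_dist_sin (x y : R) : `|sin x - sin y| <= `|x - y|.
Proof.
wlog xy : x y / x < y.
  move=> H; case: (ltgtP x y) => [/H//|/H|->]; last by rewrite !subrr normr0.
  by rewrite distrC (distrC y).
have sinC : {within `[x, y], continuous (@sin R)}.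
  by apply: continuous_subspaceT; exact: continuous_sin.
have [c _ E] := MVT xy (fun z _ => is_derive_sin z) sinC.
rewrite distrC (distrC x) E normrM ler_piMl//.
by rewrite ler_norml cos_geN1 cos_le1.
Qed.

Lemma lipschitz1_sin phi : lipschitz1 phi -> lipschitz1 (fun a => sin (phi a)).
Proof.
move=> [k k_ge0 phiL]; exists k => // a b.
exact: le_trans (ler_dist_sin _ _) (phiL _ _).
Qed.

Lemma lipschitz1_continuous phi (x : R -> J -> R) :
  lipschitz1 phi -> (forall j, continuous (x^~ j)) -> continuous (fun s => phi (x s)).
Proof.
move=> [k k_ge0 phiL] xC s; apply/cvgrPdist_le => e e_gt0.
(* Chosen so that [k * #|J| * d <= e]; the added 1 keeps the denominator positive. *)
pose d := e / (k * #|J|%:R + 1).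
have den_gt0 : 0 < k * #|J|%:R + 1 by rewrite ltr_wpDl// mulr_ge0.
have d_gt0 : 0 < d by rewrite divr_gt0.
have : \forall r \near s, forall j, `|x s j - x r j| <= d.
  apply: (@filter_forall _ _ (fun j r => `|x s j - x r j| <= d) (nbhs s)) => j.
  by move/cvgrPdist_le : (xC j s); exact.
apply: filterS => r xd; apply: le_trans (phiL _ _) _.
apply: (@le_trans _ _ (k * (\sum_(j : J) d))).
  by rewrite ler_wpM2l// ler_sum.
rewrite sumr_const -mulr_natl mulrA -[leRHS](divfK (lt0r_neq0 den_gt0)) -/d.
by rewrite mulrC ler_wpM2l ?lerDl// ltW.
Qed.

End LipschitzFunctionals.

Lemma exists_pow2_le (R : realType) (c e : R) :
  0 < e -> exists n, c / 2 ^+ n <= e.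
Proof.
move=> e_gt0; exists (Num.bound `|c / e|).
rewrite ler_pdivrMr ?exprn_gt0// mulrC -ler_pdivrMr//.
apply: le_trans (ler_norm _) _; apply: le_trans (ltW (archi_boundP (normr_ge0 _))) _.
by rewrite -natrX ler_nat ltnW// ltn_expl.
Qed.

(** * Global existence for Lipschitz autonomous systems *)

Section Picard.
Variables (R : realType) (J : finType) (F : (J -> R) -> J -> R).
Hypothesis F_lip : forall j, lipschitz1 (F^~ j).

(* Picard iterates are compared in the norm weighted by [expR (- k t)], in which
   the iteration contracts by 1/2 on the whole half-line. They are evaluated at
   [Num.max t 0] so as to be continuous on all of R. *)
Lemma global_solution (x0 : J -> R) : exists x : R -> J -> R,
  x 0 =1 x0 /\ forall (t : R) (j : J), 0 <= t -> is_derive t 1 (x^~ j) (F (x t) j).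
Proof.
(* [P] selects a primitive vanishing at 0 for every continuous function; on the other functions its
   value is arbitrary. *)
have /choice[P PP] : forall f : R -> R, exists G : R -> R, continuous f ->
    G 0 = 0 /\ forall t : R, 0 <= t -> is_derive t 1 G (f t).
  move=> f.
  have [fC|] := pselect (continuous f); last by exists (cst 0).
  by have [G HG] := exists_primitive fC; exists G.
have [l l_ge0 Fl] := lipschitz1_uniform F_lip.
(* [m] is a positive Lipschitz constant of the field for the sup norm, and [k = 2 * m] makes the
   contraction factor [m / k] equal to 1/2. *)
pose m : R := l * #|J|%:R + 1; pose k := 2 * m.
have m_gt0 : 0 < m by rewrite ltr_wpDl// mulr_ge0.
have k_gt0 : 0 < k by rewrite mulr_gt0.
have F_sup a b e j : (forall i, `|a i - b i| <= e) -> `|F a j - F b j| <= m * e.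
  move=> ab; have e_ge0 := le_trans (normr_ge0 _) (ab j).
  apply: le_trans (Fl _ _ _) _; apply: (@le_trans _ _ (l * (#|J|%:R * e))).
    by rewrite ler_wpM2l// mulr_natl -sumr_const ler_sum.
  by rewrite mulrA ler_wpM2r// lerDl.
pose z := fix z n := if n is n'.+1 then
  fun s j => x0 j + P (fun r => F (z n' r) j) (Num.max s 0) else fun s j => x0 j.
have zS n s j : z n.+1 s j = x0 j + P (fun r => F (z n r) j) (Num.max s 0) by [].
have clampC : continuous (fun s : R => Num.max s 0).
  by move=> s; apply: continuous_max; [exact: cvg_id | exact: cvg_cst].
have max_ge0 (s : R) : 0 <= Num.max s 0 by rewrite le_max lexx orbT.
have FC (y : R -> J -> R) j : (forall i, continuous (y^~ i)) ->
    continuous (fun r => F (y r) j).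
  exact: (lipschitz1_continuous (F_lip j)).
have zC n j : continuous ((z n)^~ j).
  elim: n j => [|n IHn] j; first by move=> s; exact: cvg_cst.
  move=> s; apply: cvgD; first exact: cvg_cst.
  apply: (@continuous_comp R R R (fun s => Num.max s 0) (P (fun r => F (z n r) j))).
    exact: clampC.
  by have [_ PD] := PP _ (FC _ j IHn); apply: is_derive_continuous; exact: PD.
pose c0 : R := \sum_j `|F x0 j|; pose C := c0 / k.
have c0_ge0 : 0 <= c0 by exact: sumr_ge0.
pose w (s : R) := expR (k * Num.max s 0).
have w_ge0 s : 0 <= w s by exact: expR_ge0.
(* The contraction: one integration halves the weighted distance [c] between two curves. *)
have P_diff (y y' : R -> J -> R) (c : R) s j :
    (forall i, continuous (y^~ i)) -> (forall i, continuous (y'^~ i)) ->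
    0 <= c -> (forall r i, `|y r i - y' r i| <= c * w r) ->
    `|P (fun r => F (y r) j) (Num.max s 0) - P (fun r => F (y' r) j) (Num.max s 0)|
      <= c / 2 * w s.
  move=> yC y'C c_ge0 yy'.
  have [P0 PD] := PP _ (FC _ j yC); have [P0' PD'] := PP _ (FC _ j y'C).
  pose G r := P (fun r => F (y r) j) r - P (fun r => F (y' r) j) r.
  have -> : c / 2 * w s = m * c / k * expR (k * Num.max s 0).
    by rewrite /k /w; field; rewrite gt_eqF.
  apply: (@exp_growth_bound _ k (m * c) G (fun r => F (y r) j - F (y' r) j)) => //.
  - by rewrite /G P0 P0' subrr.
  - by rewrite mulr_ge0// ltW.
  - by move=> r r_ge0; have ? := PD r r_ge0; have ? := PD' r r_ge0; exact: is_deriveB.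
  move=> r r_ge0; rewrite -mulrA; apply: F_sup => i.
  by apply: le_trans (yy' r i) _; rewrite /w max_l.
have z_step n s j : `|z n.+1 s j - z n s j| <= C * w s / 2 ^+ n.
  elim: n s j => [|n IHn] s j.
    have [P0 PD] := PP _ (FC _ j (zC 0)).
    rewrite /= expr0 divr1 [X in `|X|]addrC addKr.
    apply: (exp_growth_bound k_gt0 P0 c0_ge0 PD) => // r r_ge0.
    rewrite (@le_trans _ _ c0)//; last first.
      by rewrite ler_peMr// -[leLHS]expR0 ler_expR mulr_ge0// ltW.
    by rewrite /c0 (bigD1 j)//= lerDl sumr_ge0.
  rewrite (zS n.+1) (zS n) opprD addrACA subrr add0r.
  rewrite (_ : C * w s / 2 ^+ n.+1 = (C / 2 ^+ n) / 2 * w s); last first.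
    by rewrite exprS; field; rewrite expf_neq0// lt0r_neq0.
  apply: P_diff => //.
    by rewrite divr_ge0// ?exprn_ge0// divr_ge0// ltW.
  by move=> r i; rewrite mulrAC; exact: IHn.
have [x xz] : exists x : R -> J -> R, forall s j n,
    `|z n s j - x s j| <= 2 * (C * w s) / 2 ^+ n.
  have H (sj : R * J) := geometric_limit (fun n => z_step n sj.1 sj.2).
  by have [x xP] := choice H; exists (fun s j => x (s, j)) => s j; exact: (xP (s, j)).
(* Near [s] the weight stays below [W], so the iterates converge uniformly there and continuity
   passes to the limit by an [e / 3] argument. *)
have xC j : continuous (x^~ j).
  move=> s; apply/cvgrPdist_le => e e_gt0.
  pose W := expR (k * (Num.max s 0 + 1)).
  have wW r : Num.max r 0 <= Num.max s 0 + 1 -> w r <= W.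
    by move=> rs; rewrite ler_expR ler_pM2l.
  have e3_gt0 : 0 < e / 3 by rewrite divr_gt0.
  have [n nP] := exists_pow2_le (2 * (C * W)) e3_gt0.
  have zx r : Num.max r 0 <= Num.max s 0 + 1 -> `|z n r j - x r j| <= e / 3.
    move=> /wW wW'; apply: le_trans (xz r j n) _; apply: le_trans nP.
    by rewrite ler_pM2r ?invr_gt0 ?exprn_gt0// ler_pM2l// ler_wpM2l// divr_ge0// ltW.
  have near_max : \forall r \near s, Num.max r 0 <= Num.max s 0 + 1.
    have /cvgrPdist_le/(_ 1 ltr01) := clampC s.
    by apply: filterS => r; rewrite ler_norml => /andP[? _]; lra.
  have /cvgrPdist_le/(_ _ e3_gt0) := zC n j s.
  apply: filterS2 near_max => r /zx zr zsr.
  have zs : `|z n s j - x s j| <= e / 3 by apply: zx; rewrite lerDl.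
  have -> : x s j - x r j = - (z n s j - x s j) + (z n s j - z n r j) + (z n r j - x r j).
    by ring.
  have := ler_normD (- (z n s j - x s j) + (z n s j - z n r j)) (z n r j - x r j).
  have := ler_normD (- (z n s j - x s j)) (z n s j - z n r j).
  by rewrite normrN; lra.
(* Both [z n.+1 - x] and the difference of the integrals of [F (z n)] and [F x] are at most
   [C * w s / 2 ^+ n], for every [n]. *)
have x_fix s j : x s j = x0 j + P (fun r => F (x r) j) (Num.max s 0).
  apply/eqP; rewrite -subr_eq0 -normr_le0; apply/ler_addgt0Pr => e e_gt0; rewrite add0r.
  have [n] := exists_pow2_le (2 * (C * w s)) e_gt0; apply: le_trans.
  have C_ge0 : 0 <= 2 * C / 2 ^+ n by rewrite divr_ge0 ?exprn_ge0// mulr_ge0// divr_ge0// ltW.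
  have := P_diff _ _ _ s j (zC n) xC C_ge0.
  have xz' r i : `|z n r i - x r i| <= 2 * C / 2 ^+ n * w r.
    by apply: le_trans (xz r i n) _; rewrite le_eqVlt; apply/orP; left; apply/eqP; ring.
  move=> /(_ xz'); have := xz s j n.+1; rewrite /= exprS.
  set a := P _ _; set b := P _ _ => A1 A2.
  have -> : x s j - (x0 j + b) = - (x0 j + a - x s j) + (a - b) by ring.
  apply: le_trans (ler_normD _ _) _; rewrite normrN.
  apply: le_trans (lerD A1 A2) _; rewrite le_eqVlt; apply/orP; left; apply/eqP.
  by field; rewrite expf_neq0// lt0r_neq0.
(* The curve [x] is constant for negative times and may have a corner at 0. Without the clamp it is
   unchanged for [s >= 0] and has a two-sided derivative at 0. *)
exists (fun s j => x0 j + P (fun r => F (x r) j) s); split.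
  by move=> j; have [-> _] := PP _ (FC _ j xC); rewrite addr0.
move=> t j t_ge0.
have -> : F (fun i => x0 i + P (fun r => F (x r) i) t) j = F (x t) j.
  by congr (F _ j); apply/funext => i; rewrite x_fix max_l.
have [_ /(_ t t_ge0) PD] := PP _ (FC _ j xC).
by apply: is_derive_eq; rewrite add0r mul1r.
Qed.
End Picard.

(** * Gronwall's inequality *)

Section Gronwall.
Variables (R : realType) (J : finType).

Lemma is_derive_bigsum (f : J -> R -> R) (df : J -> R) (t : R) :
  (forall j, is_derive t 1 (f j) (df j)) ->
  is_derive t 1 (fun s => \sum_j f j s) (\sum_j df j).
Proof.
move=> fD; rewrite /index_enum; elim: (Finite.enum _) => [|j r IHr].
  rewrite big_nil (_ : (fun _ => _) = cst 0); first exact: is_derive_cst.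
  by apply/funext => s; rewrite big_nil.
rewrite big_cons (_ : (fun _ => _) = f j + (fun s => \sum_(i <- r) f i s)).
  exact: is_deriveD.
by apply/funext => s; rewrite big_cons.
Qed.

Lemma cvg_bigsum (T : Type) (G : set_system T) (FG : Filter G)
    (f : J -> T -> R) (l : J -> R) :
  (forall j, f j s @[s --> G] --> l j) ->
  \sum_j f j s @[s --> G] --> \sum_j l j.
Proof.
move=> fl; rewrite /index_enum; elim: (Finite.enum _) => [|j r IHr].
  by rewrite big_nil; under eq_cvg do rewrite big_nil; exact: cvg_cst.
by rewrite big_cons; under eq_cvg do rewrite big_cons; exact: cvgD.
Qed.

(** The sum of squares [W] satisfies [W' <= c * W], so [expR (- c * s) * W s] is nonincreasing and
    starts at 0; [U] is its opposite. *)
Lemma gronwall_eq0 (y v : R -> J -> R) (k t : R) (j : J) : 0 <= k ->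
  (forall (s : R) (i : J), 0 < s -> is_derive s 1 (y^~ i) (v s i)) ->
  (forall i, y s i @[s --> 0^'+] --> y 0 i) ->
  (forall (s : R) (i : J), 0 < s -> `|v s i| <= k * \sum_l `|y s l|) ->
  (forall i, y 0 i = 0) -> 0 <= t -> y t j = 0.
Proof.
move=> k_ge0 yD yC yv y0 t_ge0.
pose W (s : R) := \sum_i y s i ^+ 2; pose c := 2 * k * #|J|%:R.
pose U (s : R) := - (expR (- c * s) * W s).
pose dW (s : R) := \sum_i (2 * y s i * v s i).
pose dU (s : R) := expR (- c * s) * (c * W s - dW s).
have WD (s : R) : 0 < s -> is_derive s 1 W (dW s).
  move=> s_gt0; apply: is_derive_bigsum => i; have ? := yD s i s_gt0.
  by apply: is_derive_eq; rewrite /GRing.scale/=; ring.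
have dW_le (s : R) : 0 < s -> dW s <= c * W s.
  move=> s_gt0; pose Y i := `|y s i|.
  (* Each product [2 * Y i * Y l] is at most [Y i ^+ 2 + Y l ^+ 2]; the resulting double sum equals
     [c * W s]. *)
  apply: (@le_trans _ _ (\sum_i \sum_l k * (Y i ^+ 2 + Y l ^+ 2))).
    apply: ler_sum => i _; apply: le_trans (ler_norm _) _.
    rewrite -mulr_sumr !normrM (ger0_norm (_ : 0 <= 2))// -/(Y i).
    apply: le_trans (ler_wpM2l _ (yv s i s_gt0)) _; first by rewrite mulr_ge0 ?normr_ge0.

    rewrite mulrCA ler_wpM2l// mulr_sumr ler_sum// => l _; rewrite -/(Y l).
    by have := sqr_ge0 (Y i - Y l); rewrite sqrrB; lra.
  have YW : \sum_i Y i ^+ 2 = W s.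
    by apply: eq_bigr => i _; rewrite /Y real_normK// num_real.
  under eq_bigr do rewrite -mulr_sumr big_split/= sumr_const YW -mulr_natl.
  rewrite -mulr_sumr big_split/= -mulr_sumr YW sumr_const -(mulr_natl (W s)) /c.
  by rewrite le_eqVlt; apply/orP; left; apply/eqP; ring.
have UD (s : R) : 0 < s -> is_derive s 1 U (dU s).
  move=> s_gt0; have ? := WD s s_gt0; have ? := derive_expRM (- c) s.
  by apply: is_derive_eq; rewrite /dU /GRing.scale/=; ring.
have WC : W s @[s --> 0^'+] --> W 0.
  by apply: cvg_bigsum => i; under eq_cvg do rewrite expr2; rewrite expr2; exact: cvgM.
have EC : expR (- c * s) @[s --> 0^'+] --> expR (- c * 0).
  apply: cvg_at_right_filter; exact: is_derive_continuous (derive_expRM (- c) 0).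
have UC : U s @[s --> 0^'+] --> U 0 by apply: cvgN; exact: cvgM.
have := @ge0_derive_le _ U dU t UD UC _ t_ge0.
have W0 : W 0 = 0 by rewrite /W big1// => i _; rewrite y0 expr0n.
rewrite {1}/U W0 mulr0 oppr0 /U oppr_ge0 pmulr_rle0 ?expR_gt0// => W_le0.
have Wt_le0 : W t <= 0.
  apply: W_le0 => s s_gt0.
  by rewrite /dU mulr_ge0 ?expR_ge0// subr_ge0 dW_le.
apply/eqP; rewrite -sqrf_eq0 eq_le sqr_ge0 andbT; apply: le_trans Wt_le0.
by rewrite /W (bigD1 j)//= lerDl sumr_ge0// => i _; exact: sqr_ge0.
Qed.

End Gronwall.

(** * Derivatives relative to the half-line versus two-sided derivatives of coordinates *)

Section OneSidedDerivative.
Variables (R : realType) (n : nat).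
Implicit Types (f : R -> R) (x : R -> 'cV[R]_n) (t : R) (l : 'cV[R]_n).

Lemma cvg_col (T : Type) (G : set_system T) (FG : Filter G) (f : T -> 'cV[R]_n) l :
  (forall i, f s i 0 @[s --> G] --> l i 0) -> f s @[s --> G] --> l.
Proof.
move=> fl A [P lP PA]; apply: (filterS (P := [set s | forall i j, P i j (f s i j)])).
  by move=> s; exact: PA.
apply: (@filter_forall _ _ (fun i s => forall j, P i j (f s i j)) G) => i.
apply: (@filter_forall _ _ (fun j s => P i j (f s i j)) G) => j.
by move: (lP i j); rewrite ord1 => /(fl i).
Qed.

Lemma is_derive_quotientP f t (l : R) :
  is_derive t 1 f l <-> h^-1 * (f (t + h) - f t) @[h --> 0^'] --> l.
Proof.
have -> : (fun h => h^-1 * (f (t + h) - f t)) =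
    (fun h => h^-1 *: ((f \o shift t) (h *: 1) - f t)).
  by apply/funext => h /=; rewrite /GRing.scale/= mulr1 (addrC h).
split=> [[fD <-] //|fl]; split; first exact: cvgP fl.
exact: cvg_lim fl.
Qed.

Lemma dnbhs_at_right (a : R) (A : set R) : a^' A -> a^'+ A.
Proof.
rewrite /at_right /dnbhs /within/=; apply: filterS => h Ah ah.
by apply: Ah; rewrite gt_eqF.
Qed.

(** The right difference quotients at [t] are all 0. Synchronization is known for nonnegative times
    only, so at time 0 no other quotients are available. *)
Lemma is_derive_eq0_right f t (l : R) : is_derive t 1 f l ->
  (forall s, t <= s -> f s = 0) -> l = 0.
Proof.
move=> /is_derive_quotientP fl0 f0.
have fl : h^-1 * (f (t + h) - f t) @[h --> 0^'+] --> l.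
  by move=> A /fl0; exact: dnbhs_at_right.
apply: (cvg_unique _ fl) => //.
have : (cst 0 : R -> R) h @[h --> (0:R)^'+] --> (0 : R) by exact: cvg_cst.
apply: cvg_trans; apply: near_eq_cvg; near=> h.
by rewrite /= !f0 ?subrr ?mulr0// lerDl ltW.
Unshelve. all: by end_near.
Qed.

Lemma has_derivative_at_coord x t l i : has_derivative_at x t l ->
  h^-1 * (x (t + h) i 0 - x t i 0) @[h --> within [set h | 0 <= t + h] 0^'] --> l i 0.
Proof.
move=> xD; have := @coord_continuous R n 1 i 0 l.
move=> /(continuous_cvg _)/(_ xD); apply: cvg_trans; apply: near_eq_cvg.
by apply: nearW => h; rewrite /= !mxE.
Qed.

(** For [t > 0] the constraint [0 <= t + h] holds for all small [h], so the restricted limit is the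
    two-sided one. *)
Lemma has_derivative_at_is_derive x t l i : 0 < t ->
  has_derivative_at x t l -> is_derive t 1 (fun s => x s i 0) (l i 0).
Proof.
move=> t_gt0 xD; apply/is_derive_quotientP => A /(@has_derivative_at_coord _ _ _ i xD).
apply: filterS2 (dnbhs0_lt t_gt0) => h ht; apply => /=.
by have := ler_norm (- h); rewrite normrN; lra.
Qed.

Lemma has_derivative_at_cvg_right x l i :
  has_derivative_at x 0 l -> x h i 0 @[h --> 0^'+] --> x 0 i 0.
Proof.
move=> xD; pose q h := h^-1 * (x (0 + h) i 0 - x 0 i 0).
have qC : q h @[h --> 0^'+] --> l i 0.
  move=> A /(@has_derivative_at_coord _ _ _ i xD)/dnbhs_at_right.
  rewrite /at_right/within/=; apply: filterS => h + h_gt0 => /(_ h_gt0).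
  by apply; rewrite add0r ltW.
have hC : h @[h --> 0^'+] --> (0 : R) by exact: cvg_at_right_filter cvg_id.
have : x 0 i 0 + h * q h @[h --> 0^'+] --> x 0 i 0.
  rewrite -[X in _ --> X]addr0 -[X in _ --> _ + X](mul0r (l i 0)).
  by apply: cvgD; [exact: cvg_cst | exact: (cvgM hC qC)].
apply: cvg_trans; apply: near_eq_cvg; near=> h.
have h_neq0 : h != 0 by rewrite gt_eqF.
by rewrite /= /q add0r; field.
Unshelve. all: by end_near.
Qed.

Lemma is_derive_has_derivative_at x t l :
  (forall i, is_derive t 1 (fun s => x s i 0) (l i 0)) -> has_derivative_at x t l.
Proof.
move=> xD; apply: cvg_col => i.
have /is_derive_quotientP xDi := xD i.
have : h^-1 * (x (t + h) i 0 - x t i 0) @[h --> within [set h | 0 <= t + h] 0^'] --> l i 0.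
  by apply: cvg_within_filter xDi.
apply: cvg_trans; apply: near_eq_cvg.
by apply: nearW => h; rewrite /= !mxE.
Qed.

End OneSidedDerivative.

(** * The network equations *)

Section Network.
Variables (R : realType) (n nbar : nat) (PS : power_system R n nbar).
Local Notation L := (laplacian PS).
Local Notation LD := (LD PS).
Local Notation L11 := (L11 PS).
Local Notation L12 := (L12 PS).
Local Notation L22 := (L22 PS).

Lemma unitmx_ker m (A : 'M[R]_m) :
  (forall x : 'cV_m, A *m x = 0 -> x = 0) -> A \in unitmx.
Proof.
move=> kerA; rewrite -unitmx_tr -row_free_unit; apply: inj_row_free => v vA0.
by apply: trmx_inj; rewrite trmx0; apply: kerA; rewrite -[A]trmxK -trmx_mul vA0 trmx0.
Qed.

Lemma laplacian_tr : L^T = L.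
Proof.
apply/matrixP => i j; rewrite !mxE eq_sym; case: eqP => [-> //|_].
by rewrite line_symmetric; case: ifP => // ij; rewrite (line_reactance_sym ij).
Qed.

Lemma laplacian_block : L = block_mx L11 L12 L12^T L22.
Proof. by rewrite /Defs.L12 trmx_ursub laplacian_tr submxK. Qed.

Lemma laplacian_mulE (x : 'cV[R]_(n + nbar)) i :
  (L *m x) i 0 = \sum_(k | line PS i k) (line_reactance PS i k)^-1 * (x i 0 - x k 0).
Proof.
under [RHS]eq_bigr do rewrite mulrBr.
rewrite sumrB mxE (bigD1 i)//= mxE eqxx mulr_suml; congr (_ + _).
rewrite -sumrN big_mkcond [RHS]big_mkcond; apply: eq_bigr => k _; rewrite mxE eq_sym.
by case: eqVneq => [<-|_] /=; [rewrite line_irreflexive | case: ifP => _; ring].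
Qed.

(* The set where the minimum is attained is closed under adjacency. *)
Lemma laplacian_min_principle (x : 'cV[R]_(n + nbar)) (b : 'I_(n + nbar)) :
  (forall i, x b 0 <= x i 0) -> (forall i, x i 0 = x b 0 -> 0 <= (L *m x) i 0) ->
  forall i, x i 0 = x b 0.
Proof.
move=> b_min Lx_ge0 i.
have step j k : line PS j k -> x j 0 = x b 0 -> x k 0 = x b 0.
  move=> jk jb; have w_ge0 l : line PS j l ->
      0 <= (line_reactance PS j l)^-1 * (x l 0 - x j 0).
    by move=> jl; rewrite mulr_ge0 ?subr_ge0 ?jb// invr_ge0 ltW// line_reactance_gt0.
  (* Since [j] is a minimum point, all terms are nonnegative, while their sum is the opposite of
     [(L *m x) j 0], hence nonpositive. So every term vanishes. *)
  have /eqP : \sum_(l | line PS j l) (line_reactance PS j l)^-1 * (x l 0 - x j 0) = 0.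
    apply/eqP; rewrite eq_le sumr_ge0 ?andbT//.
    rewrite -oppr_ge0 -sumrN; have := Lx_ge0 j jb; rewrite laplacian_mulE.
    by under eq_bigr do rewrite -opprB mulrN.
  rewrite psumr_eq0// => /allP/(_ k (mem_index_enum k)); rewrite jk/= mulf_eq0.
  by rewrite invr_eq0 gt_eqF ?line_reactance_gt0//= subr_eq0 jb => /eqP.
have /connectP[p bp ->] := line_connected PS b i.
elim/last_ind: p bp => [//|p c IHp]; rewrite rcons_path last_rcons => /andP[bp pc].
exact: step pc (IHp bp).
Qed.

Lemma exists_argmin (x : 'cV[R]_(n + nbar)) (j : 'I_(n + nbar)) :
  exists b, forall i, x b 0 <= x i 0.
Proof.
by case: (Order.TotalTheory.arg_minP (fun i => x i 0) (erefl : xpredT j)) => b _ bP;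
  exists b => i; exact: bP.
Qed.

(** The network equation for real data: the coefficients being real, the real and imaginary parts of
    the voltages satisfy it separately. *)
Definition real_network (e v : 'cV[R]_n) (u : 'cV[R]_nbar) : Prop :=
  col_mx (LD *m (e - v)) 0 = L *m col_mx v u.

Lemma real_networkE e v u :
  real_network e v u <-> LD *m e = (LD + L11) *m v + L12 *m u /\ L12^T *m v + L22 *m u = 0.
Proof.
rewrite /real_network laplacian_block mul_block_col mulmxBr mulmxDl; split.
  by move=> /eq_col_mx[E1 <-]; split => //; rewrite -addrA -E1 addrC subrK.
by move=> [-> ->]; rewrite (addrC (LD *m v)) [_ + LD *m v + _]addrAC addrK.
Qed.

Lemma LD_mulE m (x : 'M[R]_(n, m)) i j : (LD *m x) i j = (gen_reactance PS i)^-1 * x i j.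
Proof. by rewrite mul_diag_mx !mxE. Qed.

(** At a minimum point of nonpositive value the Laplacian is nonnegative, since [e >= 0]. The
    minimum principle makes the potential constant, hence its Laplacian 0 and [e] equal to the same
    constant, which is both nonnegative and nonpositive. *)
Lemma real_network_min (n_gt0 : (0 < n)%N) e v u j : real_network e v u ->
  (forall i, 0 <= e i 0) -> col_mx v u j 0 <= 0 -> e = 0 /\ col_mx v u = 0.
Proof.
move=> net e_ge0 xj_le0; set x := col_mx v u in xj_le0 *.
have [b b_min] := exists_argmin x j.
have xb_le0 : x b 0 <= 0 := le_trans (b_min j) xj_le0.
have LxG i : (L *m x) (lshift nbar i) 0 = (gen_reactance PS i)^-1 * (e i 0 - x (lshift nbar i) 0).
  by rewrite -net col_mxEu LD_mulE col_mxEu !mxE.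
have LxN k : (L *m x) (rshift n k) 0 = 0 by rewrite -net col_mxEd mxE.
have x_cst : forall i, x i 0 = x b 0.
  apply: laplacian_min_principle => // i; rewrite -(splitK i); case: (fintype.split i) => k/= xk.
    by rewrite LxG mulr_ge0 ?invr_ge0 ?(ltW (gen_reactance_gt0 _ _))// subr_ge0 xk (le_trans xb_le0).
  by rewrite LxN.
have eE i : e i 0 = x b 0.
  have /eqP := LxG i; rewrite laplacian_mulE big1 => [|k _]; last by rewrite !x_cst subrr mulr0.
  rewrite eq_sym mulf_eq0 invr_eq0 gt_eqF ?gen_reactance_gt0//= subr_eq0 x_cst.
  by move=> /eqP.
have xb0 : x b 0 = 0 by apply/eqP; rewrite eq_le xb_le0 -(eE (Ordinal n_gt0)) e_ge0.
by split; apply/matrixP => i k; rewrite ord1 [RHS]mxE ?eE ?x_cst.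
Qed.

Lemma real_network_gt0 (n_gt0 : (0 < n)%N) e v u i : real_network e v u ->
  (forall j, 0 <= e j 0) -> e != 0 -> 0 < v i 0.
Proof.
move=> net e_ge0; rewrite ltNge; apply: contra => vi_le0.
have [|-> //] := @real_network_min n_gt0 e v u (lshift nbar i) net e_ge0.
by rewrite col_mxEu.
Qed.

(** A solution or its opposite has a nonpositive entry at the first bus, and [real_network_min]
    applies to that one. *)
Lemma real_network0 (n_gt0 : (0 < n)%N) v u : real_network 0 v u -> v = 0.
Proof.
move=> net; pose i := lshift nbar (Ordinal n_gt0).
have z_ge0 k : 0 <= (0 : 'cV[R]_n) k 0 by rewrite mxE.
have [xi_le0|xi_gt0] := leP (col_mx v u i 0) 0.
  by have [_] := real_network_min n_gt0 net z_ge0 xi_le0; rewrite -col_mx0 => /eq_col_mx[].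
have netN : real_network 0 (- v) (- u).
  move: net; rewrite /real_network -opp_col_mx mulmxN => <-.
  by rewrite opp_col_mx oppr0 !sub0r !mulmxN.
have [|_] := @real_network_min n_gt0 0 (- v) (- u) i netN z_ge0.
  by rewrite -opp_col_mx mxE oppr_le0 ltW.
by rewrite -col_mx0 => /eq_col_mx[/eqP]; rewrite oppr_eq0 => /eqP.
Qed.

(** Extend a kernel vector by 0 to the generator buses. A negative minimum would spread over the
    whole connected graph and reach a generator bus, where the value is 0; so the vector is
    nonnegative, and so is its opposite. *)
Lemma L22_unit (n_gt0 : (0 < n)%N) : L22 \in unitmx.
Proof.
have ker_ge0 (u : 'cV[R]_nbar) k : L22 *m u = 0 -> 0 <= u k 0.
  move=> Lu0; pose x : 'cV[R]_(n + nbar) := col_mx 0 u.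
  have [b b_min] := exists_argmin x (rshift n k).
  rewrite -[u k 0](col_mxEd (0 : 'cV[R]_n)); apply: le_trans (b_min _).
  rewrite leNgt; apply/negP => xb_lt0.
  have /(_ (lshift nbar (Ordinal n_gt0))) : forall i, x i 0 = x b 0.
    apply: laplacian_min_principle => // i; rewrite -(splitK i); case: (fintype.split i) => l/=.
      by rewrite col_mxEu mxE => x0; rewrite -x0 ltxx in xb_lt0.
    move=> _; rewrite laplacian_block mul_block_col col_mxEd !mulmx0 Lu0 addr0.
    by rewrite mxE.
  by rewrite col_mxEu mxE => x0; rewrite -x0 ltxx in xb_lt0.
apply: unitmx_ker => u Lu0; apply/matrixP => k l; rewrite ord1 mxE; apply/eqP.
rewrite eq_le ker_ge0// andbT -oppr_ge0.
by have := ker_ge0 (- u) k; rewrite mulmxN Lu0 oppr0 mxE; exact.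
Qed.

(** Schur complement of [L22] in the Laplacian grounded at the generator buses by [LD]. *)
Definition kron_mx : 'M[R]_n := LD + L11 - L12 *m invmx L22 *m L12^T.

(** A kernel vector, completed by the eliminated bus voltages, solves the network with zero emf. *)
Lemma kron_unit (n_gt0 : (0 < n)%N) : kron_mx \in unitmx.
Proof.
apply: unitmx_ker => v Sv0; apply: (@real_network0 n_gt0 _ (- (invmx L22 *m L12^T *m v))).
apply/real_networkE; rewrite mulmx0 !mulmxN !mulmxA mulmxV ?L22_unit// mul1mx subrr.
by split=> //; rewrite -mulmxBl -Sv0.
Qed.

Lemma real_network_kron (n_gt0 : (0 < n)%N) e v u :
  real_network e v u -> LD *m v = Gamma PS *m e.
Proof.
move=> /real_networkE[E1 E2].
have -> : v = invmx kron_mx *m (LD *m e); last by rewrite !mulmxA.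
have uE : u = - (invmx L22 *m L12^T *m v).
  rewrite -[u](mulKmx (L22_unit n_gt0)) (_ : L22 *m u = - (L12^T *m v)).
    by rewrite mulmxN mulmxA.
  by apply/eqP; rewrite -addr_eq0 addrC E2.
rewrite -[LHS](mulKmx (kron_unit n_gt0)); congr (_ *m _).
by rewrite E1 uE /kron_mx mulmxBl mulmxN !mulmxA.
Qed.

Lemma exists_real_network (n_gt0 : (0 < n)%N) e : exists v u, real_network e v u.
Proof.
have [v Sv] : exists v, kron_mx *m v = LD *m e.
  by exists (invmx kron_mx *m (LD *m e)); rewrite mulKVmx ?kron_unit.
exists v, (- (invmx L22 *m L12^T *m v)).
apply/real_networkE; rewrite !mulmxN !mulmxA mulmxV ?L22_unit// mul1mx subrr.
by split=> //; rewrite -mulmxBl -Sv.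
Qed.

End Network.

(** * Complex voltages in polar form and the power delivered by a generator *)

Section ComplexNetwork.
Variables (R : realType) (n nbar : nat) (PS : power_system R n nbar).
Implicit Types (r phi d : 'cV[R]_n).

Definition polar_re r phi : 'cV[R]_n := \col_i (r i 0 * cos (phi i 0)).
Definition polar_im r phi : 'cV[R]_n := \col_i (r i 0 * sin (phi i 0)).

(** For [r > 0] the phase is [acos (a / r)], with its sign reversed when [b < 0]. *)
Lemma polar_ex (a b : R) :
  exists r phi : R, [/\ 0 <= r, r * cos phi = a & r * sin phi = b].
Proof.
pose r := Num.sqrt (a ^+ 2 + b ^+ 2); exists r.
have rE : r ^+ 2 = a ^+ 2 + b ^+ 2 by rewrite sqr_sqrtr// addr_ge0 ?sqr_ge0.
have r_ge0 : 0 <= r by exact: sqrtr_ge0.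
have [r0|r_neq0] := eqVneq r 0.
  exists 0; move/eqP: rE; rewrite r0 expr0n/= eq_sym paddr_eq0 ?sqr_ge0//.
  by rewrite !sqrf_eq0 => /andP[/eqP-> /eqP->]; rewrite !mul0r.
have r_gt0 : 0 < r by rewrite lt0r r_neq0.
have c_itv : -1 <= a / r <= 1.
  rewrite -ler_norml normrM normfV (gtr0_norm r_gt0) ler_pdivrMr// mul1r.
  by rewrite -(ler_pXn2r (_ : 0 < 2)%N)// ?nnegrE// real_normK ?num_real// rE lerDl sqr_ge0.
have cE : r * cos (acos (a / r)) = a by rewrite acosK// mulrC divfK.
have sE : r * sin (acos (a / r)) = `|b|.
  rewrite sin_acos// -{1}(ger0_norm r_ge0) -sqrtr_sqr -sqrtrM ?sqr_ge0// -sqrtr_sqr.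
  by congr Num.sqrt; rewrite -[b ^+ 2](addKr (a ^+ 2)) -rE; field.
have [b_ge0|b_lt0] := leP 0 b.
  by exists (acos (a / r)); rewrite sE ger0_norm.
by exists (- acos (a / r)); rewrite cosN sinN mulrN sE ltr0_norm// opprK.
Qed.

(** Stated for an abstract R-linear map [p], so as to serve for both the real and the imaginary
    part. *)
Lemma network_part (p : R[i] -> R) (e v : 'cV[R[i]]_n) (u : 'cV[R[i]]_nbar) :
  {morph p : x y / x + y} -> (forall a z, p (real_complex R a * z) = a * p z) ->
  map_mx p (col_mx (complexify (LD PS) *m (e - v)) 0) =
    map_mx p (complexify (laplacian PS) *m col_mx v u) <->
  real_network PS (map_mx p e) (map_mx p v) (map_mx p u).
Proof.
move=> pD pZ.
have p0 : p 0 = 0 by apply: (addrI (p 0)); rewrite -pD !addr0.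
have pN z : p (- z) = - p z by apply/eqP; rewrite -addr_eq0 -pD addNr p0.
have pM k l (A : 'M[R]_(k, l)) (z : 'cV_l) : map_mx p (complexify A *m z) = A *m map_mx p z.
  apply/matrixP => i j; rewrite !mxE (big_morph p pD p0).
  by apply: eq_bigr => m _; rewrite !mxE pZ.
rewrite map_col_mx !pM map_col_mx /real_network.
have -> : map_mx p (e - v) = map_mx p e - map_mx p v by apply/matrixP => i j; rewrite !mxE pD pN.
by have -> : map_mx p (0 : 'cV[R[i]]_nbar) = 0 by apply/matrixP => i j; rewrite !mxE p0.
Qed.

Lemma ReD : {morph @complex.Re R : x y / x + y}.
Proof. by move=> [a b] [c d]. Qed.

Lemma ImD : {morph @complex.Im R : x y / x + y}.
Proof. by move=> [a b] [c d]. Qed.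

Lemma ReZ (a : R) z : complex.Re (real_complex R a * z) = a * complex.Re z.
Proof. by case: z => b c /=; rewrite mul0r subr0. Qed.

Lemma ImZ (a : R) z : complex.Im (real_complex R a * z) = a * complex.Im z.
Proof. by case: z => b c /=; rewrite mul0r addr0. Qed.

Lemma complex_mx_eqP k l (z w : 'M[R[i]]_(k, l)) :
  z = w <-> map_mx (@complex.Re R) z = map_mx (@complex.Re R) w /\
            map_mx (@complex.Im R) z = map_mx (@complex.Im R) w.
Proof.
split=> [->//|[/matrixP zwR /matrixP zwI]]; apply/matrixP => i j.
have := zwR i j; have := zwI i j; rewrite !mxE.
by case: (z i j) => a b; case: (w i j) => a' b' /= -> ->.
Qed.

Lemma complex_networkP e d V theta (VN : 'cV[R[i]]_nbar) :
  col_mx (complexify (LD PS) *m (polar e d - polar V theta)) 0 =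
    complexify (laplacian PS) *m col_mx (polar V theta) VN <->
  real_network PS (polar_re e d) (polar_re V theta) (map_mx (@complex.Re R) VN) /\
  real_network PS (polar_im e d) (polar_im V theta) (map_mx (@complex.Im R) VN).
Proof.
have pR r phi : map_mx (@complex.Re R) (polar r phi) = polar_re r phi.
  by apply/matrixP => i j; rewrite !mxE.
have pI r phi : map_mx (@complex.Im R) (polar r phi) = polar_im r phi.
  by apply/matrixP => i j; rewrite !mxE.
rewrite complex_mx_eqP (network_part _ _ _ ReD ReZ) (network_part _ _ _ ImD ImZ).
by rewrite !pR !pI.
Qed.

(** The coupling term of the Kron-reduced swing equation, a function of the phases alone. *)
Definition power d i : R :=
  \sum_k Gamma PS i k * (emf PS i 0 * emf PS k 0 * sin (d i 0 - d k 0)).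

(** Expanding the sine of a difference expresses the power through [Gamma] applied to the two parts
    of the emf, the form in which invariance under [Gamma] can be used. *)
Lemma powerE d i : power d i = emf PS i 0 *
  (sin (d i 0) * (Gamma PS *m polar_re (emf PS) d) i 0 -
   cos (d i 0) * (Gamma PS *m polar_im (emf PS) d) i 0).
Proof.
rewrite !mxE !mulr_sumr -sumrB mulr_sumr; apply: eq_bigr => k _.
by rewrite !mxE sinB; ring.
Qed.

Lemma power_voltage (n_gt0 : (0 < n)%N) d V theta (VN : 'cV[R[i]]_nbar) i :
  col_mx (complexify (LD PS) *m (polar (emf PS) d - polar V theta)) 0 =
    complexify (laplacian PS) *m col_mx (polar V theta) VN ->
  emf PS i 0 * V i 0 / gen_reactance PS i * sin (d i 0 - theta i 0) = power d i.
Proof.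
move=> /complex_networkP[/(real_network_kron n_gt0) kR /(real_network_kron n_gt0) kI].
by rewrite powerE -kR -kI !LD_mulE !mxE sinB; ring.
Qed.

End ComplexNetwork.

(** * Clusters and synchronization *)

Section Clusters.
Variables (n : nat) (I : {set {set 'I_n}}).
Hypothesis I_partition : finset.partition I (finset.setTfor 'I_n).

(** A representative depending only on the cluster of [i]: it turns the pairwise cluster conditions
    into one equation per index. For a partition the default [i] is never taken, as the block
    contains [i]. *)
Definition rep (i : 'I_n) : 'I_n := odflt i [pick k in finset.pblock I i].

Lemma pblock_in i : finset.pblock I i \in I.
Proof. by apply: finset.pblock_mem; rewrite (finset.cover_partition I_partition) finset.inE. Qed.

Lemma mem_pblockT i : i \in finset.pblock I i.
Proof. by rewrite finset.mem_pblock (finset.cover_partition I_partition) finset.inE. Qed.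

Lemma pblockE C i : C \in I -> i \in C -> finset.pblock I i = C.
Proof. by move=> CI iC; apply: (finset.def_pblock _ CI iC); case/and3P: I_partition. Qed.

Lemma rep_in i : rep i \in finset.pblock I i.
Proof. by rewrite /rep; case: pickP => [k //|/(_ i)]; rewrite mem_pblockT. Qed.

Lemma rep_eq C i j : C \in I -> i \in C -> j \in C -> rep i = rep j.
Proof.
move=> CI iC jC; rewrite /rep (pblockE CI iC) (pblockE CI jC).
by case: pickP => [k //|/(_ i)]; rewrite iC.
Qed.

Lemma rep_idem i : rep (rep i) = rep i.
Proof. exact: rep_eq (pblock_in i) (rep_in i) (mem_pblockT i). Qed.

Lemma XclP (T : Type) (x : 'cV[T]_n) : Xcl I x <-> forall i, x i 0 = x (rep i) 0.
Proof.
split=> [xI i|xr C CI i j iC jC].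
  exact: xI (pblock_in i) _ _ (mem_pblockT i) (rep_in i).
by rewrite /X2/= xr (xr j) (rep_eq CI iC jC).
Qed.

(** Commutation with the transposition of [i] and [j], read at the entry [(i, j)], equates the two
    diagonal entries. *)
Lemma SclP (R : realType) (d : 'rV[R]_n) :
  Scl I (diag_mx d) <-> forall i, d 0 i = d 0 (rep i).
Proof.
have S2E i j : S2 i j (diag_mx d) <-> d 0 i = d 0 j.
  rewrite /S2/= mul_diag_mx mul_mx_diag; split=> [/matrixP/(_ i j)|dij].
    by rewrite !mxE tpermL eqxx mulr1 mul1r.
  apply/matrixP => k l; rewrite !mxE; case: eqP => [<-|_]; last by rewrite mulr0 mul0r.
  by rewrite mulr1 mul1r; case: tpermP => [->|->|].
split=> [dI i|dr C CI i j iC jC].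
  exact/S2E/(dI _ (pblock_in i) _ _ (mem_pblockT i) (rep_in i)).
by apply/S2E; rewrite dr (dr j) (rep_eq CI iC jC).
Qed.

End Clusters.

(** * The swing dynamics and sufficiency of the two conditions *)

Section Synchronization.
Variables (R : realType) (n nbar : nat) (PS : power_system R n nbar).
Hypothesis n_gt0 : (0 < n)%N.
Variable I : {set {set 'I_n}}.
Hypothesis I_partition : finset.partition I (finset.setTfor 'I_n).
Hypotheses (M_Scl : Scl I (inertia_mx PS)) (D_Scl : Scl I (damping_mx PS)).
Hypotheses (f_Xcl : Xcl I (mech_power PS)) (E_Xcl : Xcl I (emf PS)).
Local Notation rep := (rep I).
Local Notation E := (emf PS).

(* First-order form of the swing equation: [inl i] carries the phase and
   [inr i] the frequency of generator [i]. *)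
Definition swing_field (a : 'I_n + 'I_n -> R) (j : 'I_n + 'I_n) : R :=
  match j with
  | inl i => a (inr i)
  | inr i => (inertia PS i)^-1 * (mech_power PS i 0 - damping PS i * a (inr i)
                                  - power PS (\col_k a (inl k)) i)
  end.

Lemma swing_field_lipschitz j : lipschitz1 (swing_field^~ j).
Proof.
case: j => i /=; first exact: lipschitz1_proj.
apply: lipschitz1M; apply: lipschitz1B.
  apply: lipschitz1B; first exact: lipschitz1_cst.
  by apply: lipschitz1M; exact: lipschitz1_proj.
apply: lipschitz1_sum => k; apply: lipschitz1M; apply: lipschitz1M.
apply: lipschitz1_sin; rewrite (_ : (fun a => _) = fun a => a (inl i) - a (inl k)).
  by apply: lipschitz1B; exact: lipschitz1_proj.
by apply/funext => a; rewrite !mxE.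
Qed.

Lemma inertia_rep i : inertia PS i = inertia PS (rep i).
Proof. by have /(SclP I_partition)/(_ i) := M_Scl; rewrite !mxE. Qed.

Lemma damping_rep i : damping PS i = damping PS (rep i).
Proof. by have /(SclP I_partition)/(_ i) := D_Scl; rewrite !mxE. Qed.

Lemma mech_power_rep i : mech_power PS i 0 = mech_power PS (rep i) 0.
Proof. by have /(XclP I_partition) := f_Xcl. Qed.

Lemma emf_rep i : E i 0 = E (rep i) 0.
Proof. by have /(XclP I_partition) := E_Xcl. Qed.

Lemma Xcl_polar_re d : Xcl I d -> Xcl I (polar_re E d).
Proof. by move=> /XclP dI; apply/XclP => // i; rewrite !mxE dI// emf_rep. Qed.

Lemma Xcl_polar_im d : Xcl I d -> Xcl I (polar_im E d).
Proof. by move=> /XclP dI; apply/XclP => // i; rewrite !mxE dI// emf_rep. Qed.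

Definition rep2 (j : 'I_n + 'I_n) : 'I_n + 'I_n :=
  match j with inl i => inl (rep i) | inr i => inr (rep i) end.

(** The state [a \o rep2] has cluster-constant phases, so both parts of its emf lie in [Xcl I], and
    [powerE] with invariance makes the power cluster-constant. *)
Lemma swing_field_sync (a : 'I_n + 'I_n -> R) j :
  (forall x : 'cV[R]_n, Xcl I x -> Xcl I (Gamma PS *m x)) ->
  swing_field (a \o rep2) j = swing_field (a \o rep2) (rep2 j).
Proof.
move=> GI; case: j => i /=; rewrite rep_idem//.
rewrite -inertia_rep -mech_power_rep -damping_rep !powerE -emf_rep.
set d := \col_k _; have dI : Xcl I d by apply/XclP => // k; rewrite !mxE /= rep_idem.
have /XclP-/(_ I_partition i) <- := GI _ (Xcl_polar_re dI).
have /XclP-/(_ I_partition i) <- := GI _ (Xcl_polar_im dI).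
by have /XclP-/(_ I_partition i) <- := dI.
Qed.

Definition state (delta omega : R -> 'cV[R]_n) (t : R) (j : 'I_n + 'I_n) : R :=
  match j with inl i => delta t i 0 | inr i => omega t i 0 end.

(** [power_voltage] eliminates the voltages from the swing equation, which is then solved for the
    acceleration. *)
Lemma solution_derivative delta omega V theta VN t :
  is_solution PS delta omega V theta VN -> 0 <= t ->
  exists l : 'I_n + 'I_n -> R, [/\ l =1 swing_field (state delta omega t),
    has_derivative_at delta t (\col_i l (inl i)) &
    has_derivative_at omega t (\col_i l (inr i))].
Proof.
move=> sol t_ge0; exists (swing_field (state delta omega t)); split => //.
  have -> : \col_i swing_field (state delta omega t) (inl i) = omega t.
    by apply/matrixP => i j; rewrite ord1 mxE.
  exact: sol_velocity sol _ t_ge0.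
have [alpha alphaD swing] := sol_swing sol t_ge0.
suff -> : \col_i swing_field (state delta omega t) (inr i) = alpha by [].
apply/matrixP => i j; rewrite ord1 mxE /=.
have -> : \col_k delta t k 0 = delta t by apply/matrixP => k l; rewrite ord1 mxE.
have := congr1 (fun x : 'cV_n => x i 0) swing.
rewrite !mul_diag_mx !mxE (power_voltage n_gt0 i (sol_network sol t_ge0)) => swing_i.
have M_neq0 : inertia PS i != 0 by rewrite gt_eqF// inertia_gt0.
apply: (mulfI M_neq0); rewrite mulrA mulfV// mul1r.
by apply/eqP; rewrite -subr_eq0; apply/eqP; lra.
Qed.

Lemma weakly_synchronized_suff :
  Scl I (LD PS) -> (forall x : 'cV[R]_n, Xcl I x -> Xcl I (Gamma PS *m x)) ->
  weakly_synchronized PS I.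
Proof.
move=> LD_Scl GI delta omega V theta VN sol d0 o0 t t_ge0.
have [k k_ge0 Fk] := lipschitz1_uniform swing_field_lipschitz.
pose F := swing_field; pose a := state delta omega.
pose y s j := a s j - a s (rep2 j).
have aD (s : R) (j : 'I_n + 'I_n) : 0 < s -> is_derive s 1 (a^~ j) (F (a s) j).
  move=> s_gt0; have [l [lF dD oD]] := solution_derivative sol (ltW s_gt0).
  rewrite /F -lF; case: j => i.
    by have := has_derivative_at_is_derive i s_gt0 dD; rewrite mxE.
  by have := has_derivative_at_is_derive i s_gt0 oD; rewrite mxE.
have aC j : a s j @[s --> 0^'+] --> a 0 j.
  have [l [_ dD oD]] := solution_derivative sol (lexx 0).
  by case: j => i; [exact: has_derivative_at_cvg_right dD|
                    exact: has_derivative_at_cvg_right oD].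
have y_eq0 j : y t j = 0.
  apply: (@gronwall_eq0 _ _ y (fun s j => F (a s) j - F (a s) (rep2 j)) (2 * k)) => //.
  - by rewrite mulr_ge0.
  - by move=> s i s_gt0; have ? := aD s i s_gt0; have ? := aD s (rep2 i) s_gt0;
      exact: is_deriveB.
  - by move=> i; exact: cvgB.
  (* At [a s \o rep2] the two components of the field agree, so their difference at [a s] is a
     difference of two Lipschitz increments, each at most [k] times the sum of the deviations
     [y]. *)
  - move=> s i _; have sync := swing_field_sync (a s) i GI.
    have := Fk i (a s) (a s \o rep2); have := Fk (rep2 i) (a s) (a s \o rep2).
    rewrite -sync -/F -[\sum_l _]/(dist1 (a s) (a s \o rep2)) => H1 H2.
    have -> : F (a s) i - F (a s) (rep2 i) = (F (a s) i - F (a s \o rep2) i)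
        - (F (a s) (rep2 i) - F (a s \o rep2) i) by ring.
    by apply: le_trans (ler_normB _ _) _; lra.
  - move=> [] i; rewrite /y /= (XclP I_partition _).1 ?subrr//.
have dI : Xcl I (delta t).
  apply/XclP => // i; have /eqP := y_eq0 (inl i).
  by rewrite subr_eq0 => /eqP.
split=> //; have [netR netI] := (complex_networkP _ _ _ _ _ _).1 (sol_network sol t_ge0).
have volt_rep v e u i : real_network PS e v u -> Xcl I e -> v i 0 = v (rep i) 0.
  move=> net eI; have kE := real_network_kron n_gt0 net.
  have /XclP-/(_ I_partition i) := GI _ eI; rewrite -kE !LD_mulE.
  have /(SclP I_partition)/(_ i) := LD_Scl; rewrite !mxE => <-.
  by apply: mulfI; rewrite invr_eq0 gt_eqF// gen_reactance_gt0.
apply/XclP => // i; rewrite !mxE.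
have := volt_rep _ _ _ i netR (Xcl_polar_re dI); rewrite !mxE => ->.
by have := volt_rep _ _ _ i netI (Xcl_polar_im dI); rewrite !mxE => ->.
Qed.


(** The trajectory starts at rest. The two-sided derivatives of its state are recorded as well, so
    that it can be differentiated at time 0. *)
Lemma exists_solution (d : 'cV[R]_n) : exists delta omega V theta VN,
  [/\ is_solution PS delta omega V theta VN, delta 0 = d, omega 0 = 0 &
    forall (t : R) (j : 'I_n + 'I_n), 0 <= t ->
      is_derive t 1 ((state delta omega)^~ j) (swing_field (state delta omega t) j)].
Proof.
have [x [x0 xD]] := global_solution swing_field_lipschitz
  (fun j => if j is inl i then d i 0 else 0).
have [delta deltaE] : exists delta : R -> 'cV[R]_n, forall t i, delta t i 0 = x t (inl i).
  by exists (fun t => \col_i x t (inl i)) => t i; rewrite mxE.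
have [omega omegaE] : exists omega : R -> 'cV[R]_n, forall t i, omega t i 0 = x t (inr i).
  by exists (fun t => \col_i x t (inr i)) => t i; rewrite mxE.
have stateE t : state delta omega t = x t.
  by apply/funext => -[] i; rewrite /= ?deltaE ?omegaE.
(* The voltages are built separately at each time: solve the two real networks, then pass to polar
   form. *)
have /choice[VV VVP] t : exists VV : 'cV[R]_n * 'cV[R]_n * 'cV[R[i]]_nbar,
    (forall i, 0 <= VV.1.1 i 0) /\
    col_mx (complexify (LD PS) *m (polar E (delta t) - polar VV.1.1 VV.1.2)) 0 =
      complexify (laplacian PS) *m col_mx (polar VV.1.1 VV.1.2) VV.2.
  have [vR [uR netR]] := exists_real_network PS n_gt0 (polar_re E (delta t)).
  have [vI [uI netI]] := exists_real_network PS n_gt0 (polar_im E (delta t)).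
  have /choice[r rP] i : exists r : R * R,
      [/\ 0 <= r.1, r.1 * cos r.2 = vR i 0 & r.1 * sin r.2 = vI i 0].
    by have [r [phi]] := polar_ex (vR i 0) (vI i 0); exists (r, phi).
  exists (\col_i (r i).1, \col_i (r i).2, \col_k Complex (uR k 0) (uI k 0)).
  split=> [i|]; first by rewrite mxE; case: (rP i).
  apply/complex_networkP => /=.
  have -> : polar_re (\col_i (r i).1) (\col_i (r i).2) = vR.
    by apply/matrixP => i j; rewrite ord1 !mxE; case: (rP i).
  have -> : polar_im (\col_i (r i).1) (\col_i (r i).2) = vI.
    by apply/matrixP => i j; rewrite ord1 !mxE; case: (rP i).
  have -> : map_mx (@complex.Re R) (\col_k Complex (uR k 0) (uI k 0)) = uR.
    by apply/matrixP => i j; rewrite ord1 !mxE.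
  have -> // : map_mx (@complex.Im R) (\col_k Complex (uR k 0) (uI k 0)) = uI.
  by apply/matrixP => i j; rewrite ord1 !mxE.
have deltaD t : 0 <= t -> has_derivative_at delta t (omega t).
  move=> t_ge0; apply: is_derive_has_derivative_at => i; rewrite omegaE.
  rewrite (_ : (fun s => _) = x^~ (inl i)); first exact: xD.
  by apply/funext => s; rewrite deltaE.
have omegaD t : 0 <= t ->
    has_derivative_at omega t (\col_i swing_field (x t) (inr i)).
  move=> t_ge0; apply: is_derive_has_derivative_at => i; rewrite mxE.
  rewrite (_ : (fun s => _) = x^~ (inr i)); first exact: xD.
  by apply/funext => s; rewrite omegaE.
exists delta, omega, (fun t => (VV t).1.1), (fun t => (VV t).1.2), (fun t => (VV t).2).
split.
- split=> // [t t_ge0|t _ i|t _]; last 2 first.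
  + by case: (VVP t).
  + by case: (VVP t).
  exists (\col_i swing_field (x t) (inr i)); first exact: omegaD.
  have [_ net] := VVP t.
  apply/matrixP => i j; rewrite ord1 !mul_diag_mx !mxE (power_voltage n_gt0 i net) /=.
  have -> : \col_k x t (inl k) = delta t by apply/matrixP => k l; rewrite ord1 mxE.
  have M_neq0 : inertia PS i != 0 by rewrite gt_eqF// inertia_gt0.
  by rewrite mulrA mulfV// mul1r omegaE; ring.
- by apply/matrixP => i j; rewrite ord1 deltaE x0.
- by apply/matrixP => i j; rewrite ord1 omegaE x0 mxE.
move=> t j t_ge0; rewrite stateE (_ : (fun s => _) = x^~ j); first exact: xD.
by apply/funext => s; rewrite stateE.
Qed.

(** * Necessity of the two conditions *)

Section Necessity.
Hypothesis sync : weakly_synchronized PS I.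

(** Follow the solution starting at rest from [d]. At time 0 the damping term vanishes, and equal
    accelerations within a cluster leave equal powers; the voltages are recovered from [Gamma] by
    dividing by [LD]. *)
Lemma sync_initial (d : 'cV[R]_n) : Xcl I d ->
  let sync_voltage e := Xcl I (\col_i (gen_reactance PS i * (Gamma PS *m e) i 0)) in
  [/\ sync_voltage (polar_re E d), sync_voltage (polar_im E d) &
    forall i, power PS d i = power PS d (rep i)].
Proof.
move=> dI sync_voltage; rewrite /sync_voltage.
have [delta [omega [V [theta [VN [sol d0 o0 stD]]]]]] := exists_solution d.
have syncI t : 0 <= t -> Xcl I (delta t) /\ Xcl I (polar (V t) (theta t)).
  by apply: (sync sol); rewrite ?d0// o0; apply/XclP => // i; rewrite !mxE.
have [netR netI] := (complex_networkP _ _ _ _ _ _).1 (sol_network sol (lexx 0)).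
have voltE e v u : real_network PS e v u ->
    \col_i (gen_reactance PS i * (Gamma PS *m e) i 0) = v.
  move=> net; apply/matrixP => i j; rewrite ord1 mxE -(real_network_kron n_gt0 net).
  by rewrite LD_mulE mulrA mulfV ?mul1r// gt_eqF// gen_reactance_gt0.
have [_ /(XclP I_partition) VI] := syncI 0 (lexx 0).
rewrite -d0 (voltE _ _ _ netR) (voltE _ _ _ netI) d0; split.
- by apply/XclP => // i; have := VI i; rewrite !mxE => -[].
- by apply/XclP => // i; have := VI i; rewrite !mxE => -[].
move=> i.
(* Phase differences within a cluster vanish for all [t >= 0], hence so do the frequency
   differences, and then the acceleration difference at 0. *)
have diffD t j := fun t_ge0 : 0 <= t =>
  is_deriveB (stD t j t_ge0) (stD t (rep2 j) t_ge0).
have delta_eq t : 0 <= t -> delta t i 0 - delta t (rep i) 0 = 0.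
  by move=> /syncI[/(XclP I_partition)/(_ i) -> _]; rewrite subrr.
have omega_eq t : 0 <= t -> omega t i 0 - omega t (rep i) 0 = 0.
  move=> t_ge0; apply: (is_derive_eq0_right (diffD t (inl i) t_ge0)) => s ts.
  exact/delta_eq/(le_trans t_ge0).
have := is_derive_eq0_right (diffD 0 (inr i) (lexx 0)) omega_eq.
rewrite /= -inertia_rep -mech_power_rep -damping_rep o0 !mxE -mulrBr.
have -> : \col_k delta 0 k 0 = d by apply/matrixP => k l; rewrite ord1 mxE d0.
move/eqP; rewrite mulf_eq0 invr_eq0 gt_eqF ?inertia_gt0//= => /eqP; lra.
Qed.

Lemma Gamma_Xcl : Scl I (LD PS) -> forall x : 'cV[R]_n, Xcl I x -> Xcl I (Gamma PS *m x).
Proof.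
move=> LD_Scl x xI.
have chi_rep i : gen_reactance PS i = gen_reactance PS (rep i).
  by have /(SclP I_partition)/(_ i) := LD_Scl; rewrite !mxE => /invr_inj.
(* [s] dominates every [x i 0 / E i 0] in absolute value, so the arguments of [asin] lie in
   [[-1, 1]]; the added 1 makes it positive. The imaginary part of the emf is then [x] divided by
   [s]. *)
pose s := \sum_i `|x i 0 / E i 0| + 1.
have s_gt0 : 0 < s by rewrite ltr_wpDl// sumr_ge0.
pose d : 'cV[R]_n := \col_i asin (x i 0 / E i 0 / s).
have dI : Xcl I d.
  by apply/XclP => // i; rewrite !mxE -emf_rep; have /XclP-/(_ I_partition i) <- := xI.
have im_d : polar_im E d = s^-1 *: x.
  apply/matrixP => i j; rewrite ord1 !mxE asinK.
    by field; rewrite !gt_eqF// emf_gt0.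
  rewrite in_itv/= -ler_norml normrM normfV (gtr0_norm s_gt0) ler_pdivrMr// mul1r.
  by rewrite /s (bigD1 i)//= -addrA lerDl addr_ge0// sumr_ge0.
have [_ /(XclP I_partition) GdI _] := sync_initial dI.
apply/XclP => // i; have := GdI i; rewrite im_d -scalemxAr !mxE -chi_rep.
by move=> /(mulfI (lt0r_neq0 (gen_reactance_gt0 PS i)))/mulfI; apply; rewrite invr_eq0 gt_eqF.
Qed.

(* With phase pi/2 on the cluster of i and 0 elsewhere, generator i delivers the
   power E_i (Gamma e)_i and the real part of its bus voltage is
   chi_i (Gamma e)_i > 0. Both are constant on the cluster, hence so is chi. *)
Lemma LD_Scl_of_sync : (2 <= #|I|)%N -> Scl I (LD PS).
Proof.
move=> I_ge2; apply/(SclP I_partition) => i; rewrite !mxE; congr (_^-1).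
pose C := finset.pblock I i.
pose d : 'cV[R]_n := \col_k if k \in C then pi / 2 else 0.
have memC k : (k \in C) = (rep k \in C).
  apply/idP/idP => [kC|rC].
    by rewrite -(rep_eq I_partition (pblock_in I_partition i) (mem_pblockT I_partition i) kC) rep_in.
  have := mem_pblockT I_partition k.
  have -> // : finset.pblock I k = C.
  rewrite -[C](pblockE I_partition (pblock_in I_partition i) rC).
  by rewrite (pblockE I_partition (pblock_in I_partition k) (rep_in I_partition k)).
have dI : Xcl I d by apply/XclP => // k; rewrite !mxE memC.
have [/(XclP I_partition) volt _ pow] := sync_initial dI.
have iC : i \in C by exact: mem_pblockT.
have powC k : k \in C -> power PS d k = E k 0 * (Gamma PS *m polar_re E d) k 0.
  by move=> kC; rewrite powerE [d k 0]mxE kC sin_pihalf cos_pihalf mul1r mul0r subr0.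
have := pow i; rewrite !powC ?rep_in// -emf_rep => /(mulfI (lt0r_neq0 (emf_gt0 PS i))) G_eq.
have := volt i; rewrite mxE [RHS]mxE -G_eq; apply: mulIf.
have [v [u net]] := exists_real_network PS n_gt0 (polar_re E d).
have vi_gt0 : 0 < v i 0.
  apply: (real_network_gt0 n_gt0 i net).
    move=> k; rewrite !mxE; case: ifP => _; first by rewrite cos_pihalf mulr0.
    by rewrite cos0 mulr1 ltW// emf_gt0.
  (* A second cluster provides a generator of phase 0, where the real part of the emf is positive;
     hence that real part is not the zero vector. *)
  have [k kC] : exists k, k \notin C.
    apply/existsP; rewrite -negb_forall; apply/negP => /forallP allC.
    suff : I \subset [set C]%SET by move=> /subset_leq_card; rewrite cards1 leqNgt I_ge2.
    apply/fintype.subsetP => B BI; rewrite finset.inE; apply/eqP.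
    have /finset.set0Pn[k kB] : B != finset.set0.
      by apply: contraTneq BI => ->; case/and3P: I_partition.
    by rewrite -(pblockE I_partition BI kB) (pblockE I_partition (pblock_in I_partition i) (allC k)).
  apply/eqP => /matrixP/(_ k 0); rewrite !mxE (negPf kC) cos0 mulr1 => /eqP.
  by rewrite gt_eqF// emf_gt0.
rewrite -(real_network_kron n_gt0 net) LD_mulE mulf_neq0// ?invr_eq0 gt_eqF//.
exact: gen_reactance_gt0.
Qed.

End Necessity.

End Synchronization.

Theorem theorem11 (R : realType) (n nbar : nat) (n_gt0 : (0 < n)%N)
    (PS : power_system R n nbar) (I : {set {set 'I_n}})
    (I_partition : finset.partition I (finset.setTfor 'I_n))
    (I_ge2 : (2 <= #|I|)%N)
    (M_Scl : Scl I (inertia_mx PS)) (D_Scl : Scl I (damping_mx PS))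
    (f_Xcl : Xcl I (mech_power PS)) (E_Xcl : Xcl I (emf PS)) :
  weakly_synchronized PS I <->
  Scl I (LD PS) /\
  (forall x : 'cV[R]_n, Xcl I x -> Xcl I (Gamma PS *m x)).
Proof.
split=> [sync|[LD_Scl GI]].
  have LD_Scl := LD_Scl_of_sync n_gt0 I_partition M_Scl D_Scl f_Xcl E_Xcl sync I_ge2.
  split=> //.
  exact: (Gamma_Xcl n_gt0 I_partition M_Scl D_Scl f_Xcl E_Xcl sync LD_Scl).
exact: (weakly_synchronized_suff n_gt0 I_partition M_Scl D_Scl f_Xcl E_Xcl LD_Scl GI).
Qed.
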